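(* Let $Q$ be a smooth manifold, $L:TQ\times\mathbb{R}\to\mathbb{R}$ a (contact) Lagrangian, and let $\tilde N\subseteq T(Q\times\mathbb{R})$ be a submanifold defined by constraints $(\phi^a)_{a=0}^k$ with $\phi^0=\dot z-L(q,\dot q,z)$. Since $\partial\phi^0/\partial\dot z\neq0$, the remaining constraints $\phi^1,\dots,\phi^k$ can be chosen independent of $\dot z$. Consider the vakonomic equations (summing over $a=0,\dots,k$ in the first two) $$\frac{\mathrm{d}}{\mathrm{d}t}\left(\lambda_a\frac{\partial\phi^a}{\partial\dot q^i}\right)-\lambda_a\frac{\partial\phi^a}{\partial q^i}=0,\qquad \frac{\mathrm{d}}{\mathrm{d}t}\left(\lambda_a\frac{\partial\phi^a}{\partial\dot z}\right)-\lambda_a\frac{\partial\phi^a}{\partial z}=0,\qquad \phi^a=0,$$ along $(\bar c(t),\dot{\bar c}(t))$, for a curve $\bar c=(c,c_z)$ in $Q\times\mathbb{R}$ and multipliers $\lambda_a(t)$, whose solutions are the critical points of the action $\bar{\mathcal{A}}(\bar c)=\int_0^1\dot c_z\,\mathrm{d}t$ restricted to the paths tangent to $\tilde N$. For $\alpha\in\{1,\dots,k\}$ and provided that $\lambda_0\neq0$, put $$\psi^\alpha(q,\dot q,z)=\phi^\alpha(q,\dot q,z,L(q,\dot q,z)),\qquad \mu_\alpha=\frac{\lambda_\alpha}{\lambda_0},\qquad \mathcal{L}_\mu(q,\dot q,z,t)=L(q,\dot q,z)-\mu_\alpha(t)\psi^\alpha(q,\dot q,z)$$ (sum over $\alpha$).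 Then from these equations one obtains $$\frac{\mathrm{d}}{\mathrm{d}t}\left(\frac{\partial\mathcal{L}_\mu}{\partial\dot q^i}\right)-\frac{\partial\mathcal{L}_\mu}{\partial q^i}=\frac{\partial\mathcal{L}_\mu}{\partial\dot q^i}\frac{\partial\mathcal{L}_\mu}{\partial z},\qquad \psi^\alpha(\bar c(t),\dot c(t))=0,\qquad \dot c_z(t)=\mathcal{L}_\mu(\bar c(t),\dot c(t),t).$$ These are just the Herglotz equations for the extended Lagrangian $$\mathcal{L}:T(Q\times\mathbb{R}^k)\times\mathbb{R}\to\mathbb{R},\qquad \mathcal{L}(q,\mu,\dot q,\dot\mu,z)=L(q,\dot q,z)-\mu_\alpha\psi^\alpha(q,\dot q,z).$$
   Context: $(q^i)$ are local coordinates on $Q$, $z$ is the coordinate on $\mathbb{R}$, and $(q^i,z,\dot q^i,\dot z)$ are the induced coordinates on $T(Q\times\mathbb{R})$. The paths considered are curves $\bar c=(c,c_z):[0,1]\to Q\times\mathbb{R}$ with $c(0)=q_0$, $c(1)=q_1$, $c_z(0)=z_0$ fixed and $c_z(1)$ free; a path is tangent to $\tilde N$ if $\dot{\bar c}(t)\in\tilde N$ for all $t$. For a Lagrangian $\Lambda:TM\times\mathbb{R}\to\mathbb{R}$ on a manifold $M$ with local coordinates $(x^j)$, the Herglotz equations for a curve $(x(t),z(t))$ are $\frac{\mathrm{d}}{\mathrm{d}t}\frac{\partial\Lambda}{\partial\dot x^j}-\frac{\partial\Lambda}{\partial x^j}=\frac{\partial\Lambda}{\partial\dot x^j}\frac{\partial\Lambda}{\partial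 z}$, where $z$ satisfies $\dot z=\Lambda(x,\dot x,z)$. For the extended Lagrangian, $M=Q\times\mathbb{R}^k$ with coordinates $(q^i,\mu_\alpha)$. *)

(* Defs.v *)
From HB Require Import structures.
From mathcomp Require Import all_boot all_order all_algebra.
From mathcomp Require Import all_classical all_reals topology normedtype derive.
Set Implicit Arguments.
Unset Strict Implicit.
Unset Printing Implicit Defensive.
Import Order.TTheory GRing.Theory Num.Theory.
Import numFieldNormedType.Exports.
Local Open Scope classical_set_scope.
Local Open Scope ring_scope.

(* On an open subset [U] of a finite-dimensional space, [Ck k U f] is the usual
   notion "f is of class C^k on U", values of [f] outside [U] being irrelevant. *)
Fixpoint Ck (R : realType) (V W : normedModType R) (k : nat) (U : set V)
    (f : V -> W) : Prop :=
  match k with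
  | 0%N => forall x, U x -> {for x, continuous f}
  | k'.+1 => (forall x, U x -> differentiable f x) /\
             (forall v, Ck k' U ('D_v f))
  end.

Definition smooth_on (R : realType) (V W : normedModType R) (U : set V)
  (f : V -> W) : Prop := forall k, Ck k U f.

(* [chart_map] and [chart_inv] are only meaningful on [dom] and on
   [chart_map @` dom] respectively. *)
Record chart (R : realType) (n : nat) (T : topologicalType) := Chart {
  dom : set T ;
  chart_map :> T -> 'rV[R]_n ;
  chart_inv : 'rV[R]_n -> T ;
  dom_open : open dom ;
  im_open : open (chart_map @` dom) ;
  chart_mapK : forall p, dom p -> chart_inv (chart_map p) = p ;
  chart_map_cont : forall p, dom p -> {for p, continuous chart_map} ;
  chart_inv_cont : forall p, dom p -> {for chart_map p, continuous chart_inv} }.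

Definition chart_image (R : realType) (n : nat) (T : topologicalType)
  (x : chart R n T) : set 'rV[R]_n := x @` dom x.

Record smoothManifold (R : realType) (n : nat) := SmoothManifold {
  carrier :> topologicalType ;
  carrier_hausdorff : hausdorff_space carrier ;
  carrier_second_countable : @second_countable carrier ;
  atlas : set (chart R n carrier) ;
  atlas_cover : forall p, exists2 x, atlas x & dom x p ;
  atlas_compat : forall x y, atlas x -> atlas y ->
    smooth_on (x @` (dom x `&` dom y)) (y \o chart_inv x) }.

Definition around (R : realType) (n : nat) (Q : smoothManifold R n)
  (p : Q) (x : chart R n Q) : Prop := atlas x /\ dom x p.

(* The tangent bundle: a tangent vector at [base] is a family of components,
   one row vector for each chart of the atlas around [base], transforming with
   the Jacobians of the changes of coordinates.  [comp_junk] makes the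
   irrelevant values canonical. *)
Record tangent (R : realType) (n : nat) (Q : smoothManifold R n) := Tangent {
  base : Q ;
  comp : chart R n Q -> 'rV[R]_n ;
  comp_compat : forall x y, around base x -> around base y ->
    comp y = 'D_(comp x) (y \o chart_inv x) (x base) ;
  comp_junk : forall x, ~ around base x -> comp x = 0 }.

Section TangentVectors.
Context {R : realType} {n : nat} {Q : smoothManifold R n}.
Implicit Types (x y : chart R n Q) (p : Q) (v : 'rV[R]_n).

Let tcomp x p v y : 'rV[R]_n :=
  if `[< around p x /\ around p y >] then 'D_v (y \o chart_inv x) (x p) else 0.

Lemma transition_differentiable x y p : around p x -> around p y ->
  differentiable (y \o chart_inv x) (x p).
Proof.
move=> [ax dx] [ay dy].
have [+ _] := atlas_compat ax ay 1%N; apply; by exists p.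
Qed.

Lemma near_chart_inv x y p : around p x -> dom y p ->
  \forall q \near x p, dom y (chart_inv x q).
Proof.
move=> [ax dx] dy; have := @chart_inv_cont _ _ _ x p dx.
apply; rewrite chart_mapK//; exact: open_nbhs_nbhs (conj (dom_open y) dy).
Qed.

Lemma near_chart_invK x p : dom x p ->
  \forall q \near x p, x (chart_inv x q) = q.
Proof.
move=> dx; have : nbhs (x p) (x @` dom x).
  by apply: open_nbhs_nbhs; split; [exact: im_open|exists p].
by apply: filterS => q [p' dp' <-]; rewrite chart_mapK.
Qed.

Lemma derive_transition x y z p v :
  around p x -> around p y -> around p z ->
  'D_v (z \o chart_inv x) (x p) =
  'D_('D_v (y \o chart_inv x) (x p)) (z \o chart_inv y) (y p).
Proof.
move=> hx hy hz.
have E : \forall q \near x p, (z \o chart_inv x) q =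
    ((z \o chart_inv y) \o (y \o chart_inv x)) q.
  apply: filterS (near_chart_inv hx hy.2) => q dq /=.
  by rewrite (chart_mapK dq).
rewrite (near_eq_derive v E).
have dxy := transition_differentiable hx hy.
have dyz := transition_differentiable hy hz.
set f := y \o chart_inv x; set g := z \o chart_inv y.
have exy : f (x p) = y p by rewrite /f /= (chart_mapK hx.2).
have dg : differentiable g (f (x p)) by rewrite exy.
rewrite deriveE; last exact: differentiable_comp.
rewrite diff_comp//.
rewrite (deriveE _ dxy) (deriveE _ dyz) -exy.
by [].
Qed.

Lemma derive_transition_id x p v : dom x p ->
  'D_v (x \o chart_inv x) (x p) = v.
Proof.
move=> dx; rewrite (@near_eq_derive _ _ _ _ id (x p) v); last first.
  exact: near_chart_invK.
by rewrite derive_id.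
Qed.

Fact tvec_compat x p v y z : around p y -> around p z ->
  tcomp x p v z = 'D_(tcomp x p v y) (z \o chart_inv y) (y p).
Proof.
move=> hy hz; rewrite /tcomp.
case: (pselect (around p x)) => hx.
  rewrite !asboolT//; exact: derive_transition.
rewrite !asboolF ?derive0// => -[] //.
Qed.

Fact tvec_junk x p v y : ~ around p y -> tcomp x p v y = 0.
Proof. by move=> hy; rewrite /tcomp asboolF// => -[]. Qed.

(* The tangent vector at [p] with components [v] in the chart [x]. *)
Definition tvec x p v : tangent Q := Tangent (@tvec_compat x p v) (@tvec_junk x p v).

Lemma comp_tvec x p v : around p x -> comp (tvec x p v) x = v.
Proof. by move=> h; rewrite /= /tcomp asboolT//; exact: derive_transition_id h.2. Qed.

Lemma tvec_comp x (w : tangent Q) : around (base w) x ->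
  tvec x (base w) (comp w x) = w.
Proof.
case: w => p f fc fj /= hx; rewrite /tvec.
have E : tcomp x p (f x) = f.
  apply/funext => y; rewrite /tcomp; case: (pselect (around p y)) => hy.
    by rewrite asboolT// (fc x y).
  by rewrite asboolF ?fj// => -[].
move: (@tvec_compat x p (f x)) (@tvec_junk x p (f x)); rewrite E => fc' fj'.
by congr Tangent; exact: Prop_irrelevance.
Qed.

End TangentVectors.

Section LocalExpressions.
Context {R : realType} {n : nat} {Q : smoothManifold R n}.

(* Local expression of a function on TQ x R, in the coordinates (q, q', z). *)
Definition loc (x : chart R n Q) (F : tangent Q -> R -> R)
    (q v : 'rV[R]_n) (z : R) : R :=
  F (tvec x (chart_inv x q) v) z.

Definition smooth_lagrangian (F : tangent Q -> R -> R) : Prop :=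
  forall x, atlas x ->
    smooth_on [set u : 'rV[R]_n * 'rV[R]_n * R | chart_image x u.1.1]
      (fun u => loc x F u.1.1 u.1.2 u.2).

(* T(Q x R) is identified with TQ x TR = TQ x R x R; its elements are written
   (w, z, z'), and its induced coordinates (q, z, q', z'). *)
Definition locT (x : chart R n Q) (F : tangent Q -> R -> R -> R)
    (q : 'rV[R]_n) (z : R) (v : 'rV[R]_n) (zd : R) : R :=
  F (tvec x (chart_inv x q) v) z zd.

Definition locTu (x : chart R n Q) (F : tangent Q -> R -> R -> R)
    (u : 'rV[R]_n * R * 'rV[R]_n * R) : R :=
  locT x F u.1.1.1 u.1.1.2 u.1.2 u.2.

(* [N] is the submanifold of T(Q x R) defined by the constraints [phi]: it is
   their common zero set, and their differentials are linearly independent at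
   each of its points. *)
Definition defined_by (m : nat) (N : set (tangent Q * R * R))
    (phi : 'I_m -> tangent Q -> R -> R -> R) : Prop :=
  [/\ forall a x, atlas x ->
        smooth_on [set u | chart_image x u.1.1.1] (locTu x (phi a)),
      forall w z zd, N (w, z, zd) <-> forall a, phi a w z zd = 0
    & forall x q z v zd, atlas x -> chart_image x q ->
        N (tvec x (chart_inv x q) v, z, zd) ->
        forall b : 'I_m -> R,
          (forall d, \sum_a b a * 'D_d (locTu x (phi a)) (q, z, v, zd) = 0) ->
          forall a, b a = 0].

End LocalExpressions.

Section Equations.
Context {R : realType}.

(* Partial derivatives of a function of (q, q', z). *)
Definition pd_q m (F : 'rV[R]_m -> 'rV[R]_m -> R -> R) (j : 'I_m) q v z : R :=
  'D_(delta_mx 0 j) (fun q' => F q' v z) q.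
Definition pd_v m (F : 'rV[R]_m -> 'rV[R]_m -> R -> R) (j : 'I_m) q v z : R :=
  'D_(delta_mx 0 j) (fun v' => F q v' z) v.
Definition pd_z m (F : 'rV[R]_m -> 'rV[R]_m -> R -> R) q v z : R :=
  derive1 (F q v) z.

Definition velocity m (q : R -> 'rV[R]_m) (t : R) : 'rV[R]_m :=
  \row_i derive1 (fun s => q s 0 i) t.

(* The Herglotz equations at time [t], in coordinates of a manifold of dimension
   [m], for the Lagrangian [F] and the curve ([q], [z]). *)
Definition herglotz m (F : 'rV[R]_m -> 'rV[R]_m -> R -> R)
    (q : R -> 'rV[R]_m) (z : R -> R) (t : R) : Prop :=
  let v := velocity q in
  (forall j,
    let p := fun s => pd_v F j (q s) (v s) (z s) in
    derivable p t 1 /\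
    derive1 p t - pd_q F j (q t) (v t) (z t)
      = pd_v F j (q t) (v t) (z t) * pd_z F (q t) (v t) (z t)) /\
  derive1 z t = F (q t) (v t) (z t).

End Equations.

Section Vakonomic.
Context {R : realType} {n : nat} {Q : smoothManifold R n}.

(* Paths [0,1] -> Q x R are restrictions of smooth curves defined on a
   neighbourhood of [0,1]; this gives derivatives a meaning at 0 and 1, where
   they do not depend on the extension. *)
Definition smooth_path (c : R -> Q) (cz : R -> R) : Prop :=
  exists U : set R, [/\ open U, `[0, 1] `<=` U,
    (forall t, U t -> {for t, continuous c}),
    (forall x, atlas x -> smooth_on (U `&` c @^-1` dom x) (x \o c))
    & smooth_on U cz].

(* The vakonomic equations at time [t] in the chart [x], where
   [m] = k+1 and phi^a is a function of (q, z, q', z'). *)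
Definition vakonomic_at (m : nat) (phi : 'I_m -> tangent Q -> R -> R -> R)
    (c : R -> Q) (cz : R -> R) (la : 'I_m -> R -> R)
    (x : chart R n Q) (t : R) : Prop :=
  let q := x \o c in
  let v := velocity q in
  let zd := derive1 cz in
  let f := fun a => locT x (phi a) in
  [/\ forall i : 'I_n,
        let p := fun s => \sum_a la a s *
          'D_(delta_mx 0 i) (fun v' => f a (q s) (cz s) v' (zd s)) (v s) in
        derivable p t 1 /\
        derive1 p t - \sum_a la a t *
          'D_(delta_mx 0 i) (fun q' => f a q' (cz t) (v t) (zd t)) (q t) = 0,
      (let p := fun s => \sum_a la a s *
         derive1 (f a (q s) (cz s) (v s)) (zd s) in
       derivable p t 1 /\
       derive1 p t - \sum_a la a t *
         derive1 (fun z' => f a (q t) z' (v t) (zd t)) (cz t) = 0)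
    & forall a, f a (q t) (cz t) (v t) (zd t) = 0].

Definition vakonomic (m : nat) (phi : 'I_m -> tangent Q -> R -> R -> R)
    (c : R -> Q) (cz : R -> R) (la : 'I_m -> R -> R) : Prop :=
  [/\ smooth_path c cz,
      forall a t, `[0, 1]%classic t -> derivable (la a) t 1
    & forall t x, `[0, 1]%classic t -> around (c t) x ->
        vakonomic_at phi c cz la x t].

Variable k : nat.
Variables (phi : 'I_k.+1 -> tangent Q -> R -> R -> R) (L : tangent Q -> R -> R).

Definition psi (al : 'I_k) (w : tangent Q) (z : R) : R :=
  phi (lift ord0 al) w z (L w z).

Definition Lmu (mu : R -> 'rV[R]_k) (t : R) (w : tangent Q) (z : R) : R :=
  L w z - \sum_al mu t 0 al * psi al w z.

Definition reduced_at (c : R -> Q) (cz : R -> R) (mu : R -> 'rV[R]_k)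
    (x : chart R n Q) (t : R) : Prop :=
  let q := x \o c in
  let v := velocity q in
  let F := fun s => loc x (Lmu mu s) in
  [/\ forall i : 'I_n,
        let p := fun s => pd_v (F s) i (q s) (v s) (cz s) in
        derivable p t 1 /\
        derive1 p t - pd_q (F t) i (q t) (v t) (cz t)
          = pd_v (F t) i (q t) (v t) (cz t) * pd_z (F t) (q t) (v t) (cz t),
      forall al, loc x (psi al) (q t) (v t) (cz t) = 0
    & derive1 cz t = F t (q t) (v t) (cz t)].

Definition reduced (c : R -> Q) (cz : R -> R) (mu : R -> 'rV[R]_k) : Prop :=
  forall t x, `[0, 1]%classic t -> around (c t) x -> reduced_at c cz mu x t.

(* The extended Lagrangian, T(Q x R^k) being identified with TQ x R^k x R^k. *)
Definition Lext (w : tangent Q) (mu mud : 'rV[R]_k) (z : R) : R :=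
  L w z - \sum_al mu 0 al * psi al w z.

(* Its local expression in the coordinates (q, mu) of Q x R^k induced by the
   chart [x] of Q. *)
Definition locLext (x : chart R n Q) (X V : 'rV[R]_(n + k)) (z : R) : R :=
  Lext (tvec x (chart_inv x (lsubmx X)) (lsubmx V)) (rsubmx X) (rsubmx V) z.

Definition herglotz_Lext (c : R -> Q) (cz : R -> R) (mu : R -> 'rV[R]_k) : Prop :=
  forall t x, `[0, 1]%classic t -> around (c t) x ->
    herglotz (locLext x) (fun s => row_mx (x (c s)) (mu s)) cz t.

End Vakonomic.

(* Main.v *)
Require Import Defs.
From HB Require Import structures.
From mathcomp Require Import all_boot all_order all_algebra.
From mathcomp Require Import ring.
From mathcomp Require Import all_classical all_reals topology normedtype landau.
From mathcomp Require Import derive.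
Set Implicit Arguments.
Unset Strict Implicit.
Unset Printing Implicit Defensive.
Import Order.TTheory GRing.Theory Num.Theory.
Import numFieldNormedType.Exports.
Local Open Scope classical_set_scope.
Local Open Scope ring_scope.

(** Write [l], [g^alpha] for [L], [psi^alpha] in a chart.  Since
    [phi^0 = zdot - l] and [phi^alpha = g^alpha] does not depend on [zdot], every
    combination [lambda_a d phi^a] in a direction other than [zdot] equals
    [- lambda_0 d (l - mu_alpha g^alpha)], while in the direction [zdot] it
    equals [lambda_0].  The second vakonomic equation is therefore
    [lambda_0' = - lambda_0 dF/dz], with [F = l - mu_alpha g^alpha], and dividing
    the first by [- lambda_0] adds to the Euler-Lagrange equation of [F] the term
    [lambda_0' / lambda_0], that is, the right-hand side of the Herglotz
    equation.

    The normalized constraints are the pull-backs of [phi^alpha] along the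
    retraction [(q, z, q', z') |-> (q, z, q', l)] onto the zero set of [phi^0].
    A linear relation among their differentials is one among the [d phi^a], with
    the coefficient of [d phi^0] corrected by the [zdot]-derivatives.

    As the extended Lagrangian does not depend on the velocity of [mu] and is
    affine in [mu], its Herglotz equations in the directions [mu_alpha] are
    [psi^alpha = 0]. *)

(** * Directional derivatives and calculus of functions of class C^k *)

Section Derivatives.
Context {R : realType}.
Implicit Types V W : normedModType R.

(** The two difference quotients are the same function of [h]. This passes from a partial derivative
    to a directional derivative on a product space, and handles functions that are constant or
    affine along a line. *)
Lemma derive_along V V' W (f : V -> W) (g : V' -> W) a v a' v' :
  (forall h : R, f (h *: v + a) = g (h *: v' + a')) ->
  'D_v f a = 'D_v' g a' /\ (derivable f a v <-> derivable g a' v').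
Proof.
move=> fg; have fg0 : f a = g a'.
  by have := fg 0; rewrite !scale0r !add0r.
rewrite /derive /derivable /=.
suff -> : (fun h : R => h^-1 *: (f (h *: v + a) - f a)) =
          (fun h => h^-1 *: (g (h *: v' + a') - g a')) by [].
by apply/funext => h; rewrite fg fg0.
Qed.

(** The first-order expansion of [f] at [x] involves only its germ, so ['d f x] serves as the
    differential of [g]. *)
Lemma near_eq_differentiable V W (f g : V -> W) x :
  (\forall y \near x, f y = g y) -> differentiable f x -> differentiable g x.
Proof.
move=> fg /diff_locallyP[fc fo]; have fgx : f x = g x := nbhs_singleton fg.
have go : g \o shift x = cst (g x) + 'd f x +o_ (0 : V) id.
  apply/eqaddoP => e e0; move/eqaddoP: fo => /(_ e e0).
  move: fg; rewrite (near_shift 0) /= subr0 => fg.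
  by apply: filterS2 fg => y /= fgy; rewrite !fctE /= fgy fgx.
by apply/diff_locallyP; rewrite (diff_unique fc go).
Qed.

Lemma Ck_eq V W k (U : set V) (f g : V -> W) : open U ->
  (forall x, U x -> f x = g x) -> Ck k U f -> Ck k U g.
Proof.
move=> oU; elim: k f g => [|k IH] f g fg;
  have nfg x : U x -> \forall y \near x, f y = g y
    by move=> Ux; apply: filterS (open_nbhs_nbhs (conj oU Ux)) => y /fg.
  move=> fc x Ux; have := fc x Ux; rewrite /prop_for /continuous_at -(fg _ Ux).
  by apply: cvg_trans; apply: near_eq_cvg; exact: nfg.
case=> df Df; split=> [x Ux|v].
  exact: near_eq_differentiable (nfg x Ux) (df x Ux).
apply: IH (Df v) => x Ux; exact: near_eq_derive (nfg x Ux).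
Qed.

Lemma Ck_pred V W k (U : set V) (f : V -> W) : Ck k.+1 U f -> Ck k U f.
Proof.
elim: k f => [|k IH] f [df Df].
  by move=> x Ux; exact: differentiable_continuous (df x Ux).
by split=> // v; exact/IH/Df.
Qed.

Lemma Ck_cst V W k (U : set V) (c : W) : Ck k U (cst c).
Proof.
elim: k c => [|k IH] c; first by move=> x _; exact: cvg_cst.
split=> [x _|v]; first exact: differentiable_cst.
rewrite (_ : 'D_v (cst c) = cst 0); first exact: IH.
by apply/funext => x; rewrite derive_cst.
Qed.

Lemma CkD V W k (U : set V) (f g : V -> W) : open U ->
  Ck k U f -> Ck k U g -> Ck k U (f + g).
Proof.
move=> oU; elim: k f g => [|k IH] f g.
  by move=> cf cg x Ux; apply: cvgD; [exact: cf|exact: cg].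
move=> [df Df] [dg Dg]; split=> [x Ux|v].
  by apply: differentiableD; [exact: df|exact: dg].
apply: (Ck_eq oU _ (IH _ _ (Df v) (Dg v))) => x Ux.
by rewrite deriveD//; apply: diff_derivable; [exact: df|exact: dg].
Qed.

(** By the Leibniz rule the derivative contains [f] and [g] themselves, so the induction first
    lowers their class by one with [Ck_pred]. *)
Lemma CkM V k (U : set V) (f g : V -> R) : open U ->
  Ck k U f -> Ck k U g -> Ck k U (f * g).
Proof.
move=> oU; elim: k f g => [|k IH] f g.
  by move=> cf cg x Ux; apply: cvgM; [exact: cf|exact: cg].
move=> cf cg; have [df Df] := cf; have [dg Dg] := cg.
split=> [x Ux|v].
  by apply: differentiableM; [exact: df|exact: dg].
have := CkD oU (IH _ _ (Ck_pred cf) (Dg v)) (IH _ _ (Ck_pred cg) (Df v)).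
apply: (Ck_eq oU) => x Ux.
by rewrite deriveM//; apply: diff_derivable; [exact: df|exact: dg].
Qed.

Section AffineAlongAVector.
Context {V V' : normedModType R} (U : set V) (U' : set V').
Context (A : {linear V -> V'}) (h : V -> R) (e : V').
Hypothesis A_cont : continuous A.
Hypothesis maps : forall x, U x -> U' (A x + h x *: e).

Lemma differentiable_linear_plus x : differentiable h x ->
  differentiable (fun y => A y + h y *: e) x.
Proof.
move=> dh; apply: differentiableD; first exact: linear_differentiable.
exact: differentiableZl.
Qed.

Lemma derive_comp_linear_plus W (g : V' -> W) x v : differentiable h x ->
  differentiable g (A x + h x *: e) ->
  'D_v (fun y => g (A y + h y *: e)) x =
  'D_(A v) g (A x + h x *: e) + 'D_v h x *: 'D_e g (A x + h x *: e).
Proof.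
move=> dh dg; have dF := differentiable_linear_plus dh.
rewrite deriveE; last exact: (differentiable_comp dF).
rewrite (@diff_comp _ _ _ _ (fun y => A y + h y *: e) g)//= !deriveE//.
have lin := @linear_differentiable _ _ _ A x A_cont.
have := diffD lin (differentiableZl e dh).
rewrite diff_lin// diffZl// => /(congr1 (@^~ v)) /= ->.
by rewrite linearD linearZ.
Qed.

(** The derivative along [v] of this composite involves [g] only through its derivatives in the
    fixed directions [A v] and [e], composed with the same map. These are composites of the same
    shape, so the induction on [k] closes by sums and products. *)
Lemma Ck_comp_linear_plus k (g : V' -> R) : open U ->
  Ck k U h -> Ck k U' g -> Ck k U (fun y => g (A y + h y *: e)).
Proof.
move=> oU; elim: k g => [|k IH] g.
  move=> ch cg x Ux.
  apply: (@continuous_comp _ _ _ (fun y => A y + h y *: e) g).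
    apply: cvgD; first exact: A_cont.
    by apply: cvgZl; exact: ch.
  exact/cg/maps.
move=> ch cg; have [dh Dh] := ch; have [dg Dg] := cg.
split=> [x Ux|v].
  apply: (@differentiable_comp _ _ _ _ (fun y => A y + h y *: e) g).
    exact/differentiable_linear_plus/dh.
  exact/dg/maps.
have := CkD oU (IH _ (Ck_pred ch) (Dg (A v)))
  (CkM oU (Dh v) (IH _ (Ck_pred ch) (Dg e))).
apply: (Ck_eq oU) => x Ux.
rewrite derive_comp_linear_plus//; first exact: dh.
exact/dg/maps.
Qed.

End AffineAlongAVector.

End Derivatives.

(** * Continuity of pairs and projections *)

Section ContinuousPairs.
Context {T U V : topologicalType}.

Lemma continuous_pair (f : T -> U) (g : T -> V) x :
  {for x, continuous f} -> {for x, continuous g} ->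
  {for x, continuous (fun y => (f y, g y))}.
Proof. by move=> cf cg; exact: (@cvg_pair _ _ _ (nbhs x) _ _ _ _ _ f g cf cg). Qed.

Lemma continuous_fst (f : T -> U * V) x :
  {for x, continuous f} -> {for x, continuous (fun y => (f y).1)}.
Proof.
move=> cf; apply: (@continuous_comp _ _ _ f fst) cf _.
exact: (@cvg_fst _ _ (nbhs (f x).1) (nbhs (f x).2)).
Qed.

Lemma continuous_snd (f : T -> U * V) x :
  {for x, continuous f} -> {for x, continuous (fun y => (f y).2)}.
Proof.
move=> cf; apply: (@continuous_comp _ _ _ f snd) cf _.
exact: (@cvg_snd _ _ (nbhs (f x).1) (nbhs (f x).2)).
Qed.

End ContinuousPairs.

(** * Linear maps on the coordinates (q, z, q', z') *)

Section NormalizedConstraints.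
Context {R : realType} {n : nat}.

(** Linear part of the retraction onto the zero set of phi^0; the rest is the value of the
    Lagrangian times [zdot_dir]. *)
Definition drop_zdot (u : 'rV[R]_n * R * 'rV[R]_n * R) :
  'rV[R]_n * R * 'rV[R]_n * R := (u.1, 0).

Fact drop_zdot_is_linear : linear drop_zdot.
Proof.
by move=> a u w; rewrite /drop_zdot /=; congr pair; rewrite /= scaler0 addr0.
Qed.
HB.instance Definition _ := GRing.isLinear.Build R _ _ _ drop_zdot
  drop_zdot_is_linear.

Lemma drop_zdot_continuous : continuous drop_zdot.
Proof.
move=> u; apply: (@continuous_pair _ _ _ fst (cst 0)); last exact: cvg_cst.
by apply: continuous_fst; exact: cvg_id.
Qed.

(** The result is reordered as (q, q', z), the order of arguments of [loc]. *)
Definition forget_zdot (u : 'rV[R]_n * R * 'rV[R]_n * R) :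
  'rV[R]_n * 'rV[R]_n * R := (u.1.1.1, u.1.2, u.1.1.2).

Fact forget_zdot_is_linear : linear forget_zdot.
Proof. by []. Qed.
HB.instance Definition _ := GRing.isLinear.Build R _ _ _ forget_zdot
  forget_zdot_is_linear.

Lemma forget_zdot_continuous : continuous forget_zdot.
Proof.
move=> u; apply: (@continuous_pair _ _ _ (fun u => (u.1.1.1, u.1.2))
  (fun u => u.1.1.2)).
  apply: (@continuous_pair _ _ _ (fun u => u.1.1.1) (fun u => u.1.2)).
- by do 3!apply: continuous_fst; exact: cvg_id.
- by apply: continuous_snd; apply: continuous_fst; exact: cvg_id.
- by apply: continuous_snd; do 2!apply: continuous_fst; exact: cvg_id.
Qed.

Definition zdot_dir : 'rV[R]_n * R * 'rV[R]_n * R := (0, 1).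

Lemma drop_zdotE u (r : R) : drop_zdot u + r *: zdot_dir = (u.1, r).
Proof.
rewrite /drop_zdot /zdot_dir; apply: injective_projections => /=.
  by rewrite scaler0 addr0.
by rewrite add0r [_ *: _]mulr1.
Qed.

End NormalizedConstraints.

Lemma derive_linear_dir (R : realType) (V W : normedModType R) (f : V -> W)
  x v (r : R) w : differentiable f x ->
  'D_(v + r *: w) f x = 'D_v f x + r *: 'D_w f x.
Proof. by move=> df; rewrite !deriveE// linearD linearZ. Qed.

(** * Making the constraints phi^1, ..., phi^k independent of z' *)

Section Manifold.
Context {R : realType} {n : nat} {Q : smoothManifold R n}.
Context (L : tangent Q -> R -> R) (L_smooth : smooth_lagrangian L).

Definition lagrangian_zdot (x : chart R n Q)
  (u : 'rV[R]_n * R * 'rV[R]_n * R) : R := loc x L u.1.1.1 u.1.2 u.1.1.2.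

Lemma open_over_chart (x : chart R n Q) :
  open [set u : 'rV[R]_n * R * 'rV[R]_n * R | chart_image x u.1.1.1].
Proof.
rewrite (_ : mkset _ = (fun u => u.1.1.1) @^-1` chart_image x)//.
apply: open_comp; last exact: im_open.
move=> u _; apply: (@continuous_fst _ _ _ (fun u => u.1.1)).
apply: (@continuous_fst _ _ _ fst); apply: (@continuous_fst _ _ _ id).
exact: cvg_id.
Qed.

Lemma lagrangian_zdot_smooth (x : chart R n Q) : atlas x ->
  smooth_on [set u | chart_image x u.1.1.1] (lagrangian_zdot x).
Proof.
move=> ax k.
(* Composition with a purely linear map: both the coefficient [h] and the vector [e] are taken to be
   zero. *)
have := @Ck_comp_linear_plus _ _ _ [set u | chart_image x u.1.1.1]
  [set u | chart_image x u.1.1] forget_zdot (cst 0) 0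
  forget_zdot_continuous _ k _ (@open_over_chart x) (Ck_cst _ _ _)
  (L_smooth ax k).
move=> H; apply: (Ck_eq (@open_over_chart x) _ (H _)) => [u _|u /=].
  by rewrite scale0r addr0.
by rewrite scale0r addr0.
Qed.

Lemma derive_lagrangian_zdot_dir (x : chart R n Q) u :
  'D_zdot_dir (lagrangian_zdot x) u = 0.
Proof.
(* Along [zdot_dir] the function is constant, which is expressed as a constant function on [R^o]
   moved in the null direction. *)
have const (h : R) : lagrangian_zdot x (h *: zdot_dir + u) =
    cst (lagrangian_zdot x u) (h *: (0 : R^o) + 0).
  by rewrite /lagrangian_zdot /zdot_dir /=; rewrite !(scaler0, add0r).
by have [-> _] := derive_along const; exact: derive_cst.
Qed.

Definition eliminate_zdot k (phi : 'I_k.+1 -> tangent Q -> R -> R -> R)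
    (a : 'I_k.+1) (w : tangent Q) (z zd : R) : R :=
  if a == ord0 then phi a w z zd else phi a w z (L w z).

Lemma eliminate_zdot_lift k phi (al : 'I_k) (x : chart R n Q) u :
  locTu x (eliminate_zdot phi (lift ord0 al)) u =
  locTu x (phi (lift ord0 al)) (drop_zdot u + lagrangian_zdot x u *: zdot_dir).
Proof. by rewrite drop_zdotE /locTu /locT. Qed.

Lemma defined_by_eliminate_zdot k (N : set (tangent Q * R * R))
    (phi : 'I_k.+1 -> tangent Q -> R -> R -> R) :
  phi ord0 = (fun w z zd => zd - L w z) ->
  defined_by N phi -> defined_by N (eliminate_zdot phi).
Proof.
move=> phi0 [phi_smooth phi_zeros phi_indep].
have maps x u : chart_image x u.1.1.1 ->
    chart_image x (drop_zdot u + lagrangian_zdot x u *: zdot_dir).1.1.1.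
  by rewrite drop_zdotE.
split.
- move=> a x ax; case: (unliftP ord0 a) => [al|] ->; last first.
    exact: (phi_smooth ord0).
  move=> m.
  rewrite (_ : locTu _ _ = fun u => locTu x (phi (lift ord0 al))
      (drop_zdot u + lagrangian_zdot x u *: zdot_dir)); last first.
    by apply/funext => u; exact: eliminate_zdot_lift.
  apply: (@Ck_comp_linear_plus _ _ _ _ [set u | chart_image x u.1.1.1]).
  + exact: drop_zdot_continuous.
  + exact: maps.
  + exact: open_over_chart.
  + exact: lagrangian_zdot_smooth.
  + exact: phi_smooth.
(* Both families contain phi^0, so a common zero of either satisfies z' = L, and there the two
   families take the same values. *)
- move=> w z zd; rewrite phi_zeros; split=> H a;
    have /eqP := H ord0; rewrite /eliminate_zdot/= ?phi0 subr_eq0 => /eqP zdE.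
    by case: ifP => _; rewrite -?zdE.
  by have := H a; rewrite /eliminate_zdot; case: ifP => // _; rewrite -zdE.
move=> x q z v zd ax xq Nqv b bD.
set p := (q, z, v, zd) in bD *.
have hp : lagrangian_zdot x p = zd.
  by have /phi_zeros/(_ ord0)/eqP := Nqv; rewrite phi0 subr_eq0 => /eqP.
(* A point of [N] is fixed by the retraction, so the chain rule evaluates the differentials of
   phi^alpha at [p] itself. *)
have Fp : drop_zdot p + lagrangian_zdot x p *: zdot_dir = p.
  by rewrite drop_zdotE hp.
have dh : differentiable (lagrangian_zdot x) p.
  by have [+ _] := lagrangian_zdot_smooth ax 1%N; exact.
have dphi a : differentiable (locTu x (phi a)) p.
  by have [+ _] := phi_smooth a x ax 1%N; exact.
pose e0 := @zdot_dir R n.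
have D0 d : 'D_d (locTu x (phi ord0)) p = d.2 - 'D_d (lagrangian_zdot x) p.
  rewrite (_ : locTu x (phi ord0) = snd - lagrangian_zdot x); last first.
    by rewrite phi0.
  have dsnd : differentiable (snd : 'rV[R]_n * R * 'rV[R]_n * R -> R) p.
    apply: linear_differentiable => u; apply: continuous_snd; exact: cvg_id.
  rewrite deriveB; [|exact: diff_derivable..].
  rewrite [X in X - _]deriveE// diff_lin// => u.
  by apply: continuous_snd; exact: cvg_id.
have DS al d : 'D_d (locTu x (eliminate_zdot phi (lift ord0 al))) p =
    'D_(drop_zdot d) (locTu x (phi (lift ord0 al))) p +
    'D_d (lagrangian_zdot x) p * 'D_e0 (locTu x (phi (lift ord0 al))) p.
  rewrite (_ : locTu _ _ = fun u => locTu x (phi (lift ord0 al))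
      (drop_zdot u + lagrangian_zdot x u *: zdot_dir)); last first.
    by apply/funext => u; exact: eliminate_zdot_lift.
  rewrite derive_comp_linear_plus//.
  - by rewrite Fp.
  - exact: drop_zdot_continuous.
  - by rewrite Fp; exact: dphi.
have DE al d : 'D_d (locTu x (phi (lift ord0 al))) p =
    'D_(drop_zdot d) (locTu x (phi (lift ord0 al))) p +
    d.2 * 'D_e0 (locTu x (phi (lift ord0 al))) p.
  have dE : d = drop_zdot d + d.2 *: e0 by rewrite drop_zdotE; case: d.
  rewrite [in LHS]dE.
  exact: derive_linear_dir (dphi (lift ord0 al)).
(* Evaluate the relation in the z' direction: the new constraints have derivative 0 there, and phi^0
   has derivative 1. *)
have b0 : b ord0 = 0.
  have := bD e0; rewrite big_ord_recl big1 => [|al _].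
    rewrite addr0 (D0 e0) derive_lagrangian_zdot_dir subr0 [e0.2]/= mulr1.
    by [].
  rewrite DS derive_lagrangian_zdot_dir mul0r addr0.
  by rewrite (_ : drop_zdot e0 = 0) ?derive0 ?mulr0.
(* At [p], the differential of phi^alpha is that of the new constraint plus its z'-derivative times
   the differential of phi^0. *)
have DSE al d : 'D_d (locTu x (phi (lift ord0 al))) p =
    'D_d (locTu x (eliminate_zdot phi (lift ord0 al))) p +
    (d.2 - 'D_d (lagrangian_zdot x) p) *
    'D_e0 (locTu x (phi (lift ord0 al))) p.
  by rewrite DS DE mulrBl addrACA subrr addr0.
(* Combining the previous identity with coefficients [b] leaves [S] times the differential of phi^0;
   the coefficient [- S] at index 0 cancels it and gives a relation among the original
   differentials. *)
pose S := \sum_al b (lift ord0 al) * 'D_e0 (locTu x (phi (lift ord0 al))) p.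
pose b' a := if a == ord0 then - S else b a.
have b'D d : \sum_a b' a * 'D_d (locTu x (phi a)) p = 0.
  have := bD d; rewrite big_ord_recl b0 mul0r add0r => bDd.
  rewrite big_ord_recl D0 [X in _ + X](eq_bigr (fun al =>
    b (lift ord0 al) *
      'D_d (locTu x (eliminate_zdot phi (lift ord0 al))) p +
    (d.2 - 'D_d (lagrangian_zdot x) p) *
      (b (lift ord0 al) * 'D_e0 (locTu x (phi (lift ord0 al))) p))).
    rewrite big_split /= bDd add0r -mulr_sumr -/S.
    by rewrite /b' eqxx mulNr mulrC addNr.
  by move=> al _; rewrite DSE mulrDr mulrCA.
move=> a; case: (unliftP ord0 a) => [al|] -> //.
exact: (phi_indep x q z v zd ax xq Nqv b' b'D (lift ord0 al)).
Qed.

End Manifold.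

(** * Dividing the multipliers by lambda_0 *)

Section Multipliers.
Context {R : realType} {k : nat}.

Lemma derivable_Lagrangian_combination (V : normedModType R)
    (mu : 'I_k -> R) (l : V -> R) (g : 'I_k -> V -> R) a e :
  derivable l a e -> (forall al, derivable (g al) a e) ->
  'D_e (fun y => l y - \sum_al mu al * g al y) a =
  'D_e l a - \sum_al mu al * 'D_e (g al) a.
Proof.
move=> dl dg.
have dmg al : is_derive a e (mu al *: g al) (mu al *: 'D_e (g al) a).
  by apply: is_deriveZ; exact: derivableP.
have := is_deriveB (derivableP dl) (is_derive_sum dmg).
move=> /@derive_val <-; congr ('D_e _ a).
by apply/funext => y; rewrite /= fct_sumE.
Qed.

(** The space [V] is arbitrary so that one computation covers the derivatives in q, q' and z; [zd]
    is a constant because z' is not varied in any of them. *)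
Lemma derive_multipliers (V : normedModType R) (la : 'I_k.+1 -> R)
    (l : V -> R) (g : 'I_k -> V -> R) (zd : R) a e :
  la ord0 != 0 ->
  derivable l a e -> (forall al, derivable (g al) a e) ->
  la ord0 * 'D_e (fun y => zd - l y) a +
    \sum_(al < k) la (lift ord0 al) * 'D_e (g al) a =
  - la ord0 *
    'D_e (fun y => l y - \sum_al la (lift ord0 al) / la ord0 * g al y) a.
Proof.
move=> la0 dl dg; rewrite derivable_Lagrangian_combination//.
have -> : 'D_e (fun y => zd - l y) a = - 'D_e l a.
  have := is_deriveB (is_derive_cst zd a e) (derivableP dl).
  by move=> /@derive_val; rewrite sub0r.
rewrite mulrBr mulNr mulrN mulNr opprK; congr (_ + _).
rewrite mulr_sumr; apply: eq_bigr => al _.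
by rewrite mulrA mulrCA divff// mulr1.
Qed.

End Multipliers.

(** Near [t] one has G = - p / la0, which is derivable as a quotient; the quotient rule yields Gq
    from the derivative of [p] and G Gz from that of [la0]. *)
Lemma herglotz_of_euler_lagrange (R : realType) (la0 p G : R -> R) (t Gq Gz : R) :
  la0 t != 0 -> derivable la0 t 1 -> derivable p t 1 ->
  (\forall s \near t, p s = - la0 s * G s) ->
  derive1 p t = - la0 t * Gq -> derive1 la0 t = - la0 t * Gz ->
  derivable G t 1 /\ derive1 G t - Gq = G t * Gz.
Proof.
move=> la0t dla dp pE; rewrite !derive1E => Dp Dla.
have nz : \forall s \near t, la0 s != 0.
  have cla : la0 s @[s --> t] --> la0 t.
    exact/differentiable_continuous/derivable1_diffP.
  exact: cvgr_neq0 cla la0t.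
have GE : \forall s \near t, (- p * (fun s => (la0 s)^-1)) s = G s.
  apply: filterS2 pE nz => s ps ls; rewrite !fctE ps !mulNr opprK.
  by rewrite mulrC mulKf.
have dV := derivableV la0t dla.
have dN := derivableN dp.
split; first exact: (near_eq_derivable GE (derivableM dN dV)).
rewrite -(near_eq_derive _ GE) (deriveM dN dV) (deriveN dp).
rewrite (deriveV la0t dla) Dp Dla -(nbhs_singleton GE) !fctE.
(* Scalar multiplications on [R] are restated as products, by conversion, so that [field]
   applies. *)
rewrite -[LHS]/(- p t * (- la0 t ^- 2 * (- la0 t * Gz)) +
  (la0 t)^-1 * - (- la0 t * Gq) - Gq).
by field.
Qed.

Section Partials.
Context {R : realType} {m : nat}.

(** Each partial derivative is the joint one in a direction with a single nonzero component. *)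
Lemma partials_derivable (G : 'rV[R]_m -> 'rV[R]_m -> R -> R) q v z :
  differentiable (fun u : 'rV[R]_m * 'rV[R]_m * R => G u.1.1 u.1.2 u.2)
    (q, v, z) ->
  [/\ forall d, derivable (fun q' => G q' v z) q d,
      forall d, derivable (fun v' => G q v' z) v d
    & forall d, derivable (G q v) z d].
Proof.
set F := fun _ => _ => dF; split=> d.
- have E (h : R) : G (h *: d + q) v z = F (h *: (d, 0, 0) + (q, v, z)).
    by rewrite /F /= !(scaler0, add0r).
  have [_ H] := @derive_along _ _ _ _ (fun q' => G q' v z) F q d (q, v, z)
    (d, 0, 0) E.
  by apply/H; exact: diff_derivable.
- have E (h : R) : G q (h *: d + v) z = F (h *: (0, d, 0) + (q, v, z)).
    by rewrite /F /= !(scaler0, add0r).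
  have [_ H] := @derive_along _ _ _ _ (fun v' => G q v' z) F v d (q, v, z)
    (0, d, 0) E.
  by apply/H; exact: diff_derivable.
- have E (h : R) : G q v (h *: d + z) = F (h *: (0, 0, d) + (q, v, z)).
    by rewrite /F /= !(scaler0, add0r).
  have [_ H] := @derive_along _ _ _ _ (G q v) F z d (q, v, z)
    (0, 0, d) E.
  by apply/H; exact: diff_derivable.
Qed.

End Partials.

Lemma derive1_subr (R : realType) (C t : R) : derive1 (fun s => s - C) t = 1.
Proof.
have := is_deriveB (is_derive_id t 1) (is_derive_cst C t 1).
by rewrite derive1E => /@derive_val ->; rewrite subr0.
Qed.

(** * From the vakonomic equations to the reduced equations *)

Section Reduction.
Context {R : realType} {n k : nat} {Q : smoothManifold R n}.
Context (phi : 'I_k.+1 -> tangent Q -> R -> R -> R) (L : tangent Q -> R -> R).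

Section FromVakonomic.
Hypothesis L_smooth : smooth_lagrangian L.
Hypothesis phi_smooth : forall a x, atlas x ->
  smooth_on [set u | chart_image x u.1.1.1] (locTu x (phi a)).
Hypothesis phi0 : phi ord0 = fun w z zd => zd - L w z.
Hypothesis phi_zdot : forall (al : 'I_k) w z zd zd',
  phi (lift ord0 al) w z zd = phi (lift ord0 al) w z zd'.

Lemma differentiable_psi (x : chart R n Q) al q v z :
  atlas x -> chart_image x q ->
  differentiable (fun u : 'rV[R]_n * 'rV[R]_n * R =>
    loc x (psi phi L al) u.1.1 u.1.2 u.2) (q, v, z).
Proof.
move=> ax xq.
(* As phi^alpha is independent of z', the argument L may be replaced by 0, and psi^alpha becomes
   phi^alpha after an inclusion of coordinates. *)
have -> : (fun u => loc x (psi phi L al) u.1.1 u.1.2 u.2) =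
    locTu x (phi (lift ord0 al)) \o (fun u => (u.1.1, u.2, u.1.2, 0)).
  by apply/funext => u; rewrite /loc /psi /= (phi_zdot _ _ _ _ 0).
apply: differentiable_comp; last first.
  by have [+ _] := phi_smooth (lift ord0 al) ax 1%N; exact.
pose V : normedModType R := ('rV[R]_n * 'rV[R]_n * R)%type.
have d1 : differentiable (fst : V -> _) (q, v, z).
  by apply: linear_differentiable => u; apply: continuous_fst; exact: cvg_id.
have d2 : differentiable (snd : V -> _) (q, v, z).
  by apply: linear_differentiable => u; apply: continuous_snd; exact: cvg_id.
have d11 : differentiable (fun u : V => u.1.1) (q, v, z).
  apply: (differentiable_comp d1).
  by apply: linear_differentiable => u; apply: continuous_fst; exact: cvg_id.
have d12 : differentiable (fun u : V => u.1.2) (q, v, z).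
  apply: (differentiable_comp d1).
  by apply: linear_differentiable => u; apply: continuous_snd; exact: cvg_id.
apply: differentiable_pair; last exact: differentiable_cst.
apply: differentiable_pair; last exact: d12.
exact: differentiable_pair.
Qed.

Variables (c : R -> Q) (cz : R -> R) (la : 'I_k.+1 -> R -> R).
Hypothesis vak : vakonomic phi c cz la.
Hypothesis la0 : forall t, `[0, 1]%classic t -> la ord0 t != 0.

Let mu t : 'rV[R]_k := \row_(al < k) (la (lift ord0 al) t / la ord0 t).

(** The maps [A], [B], [C] select the varied argument: one of them will be the identity and the
    other two constant, which gives the sums in q, q' and z. *)
Lemma derive_vakonomic_multipliers (x : chart R n Q) s
    (V : normedModType R) (A B : V -> 'rV[R]_n) (C : V -> R) zd a e :
  la ord0 s != 0 ->
  derivable (fun y => loc x L (A y) (B y) (C y)) a e ->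
  (forall al, derivable (fun y => loc x (psi phi L al) (A y) (B y) (C y)) a e) ->
  \sum_b la b s * 'D_e (fun y => locT x (phi b) (A y) (C y) (B y) zd) a =
  - la ord0 s * 'D_e (fun y => loc x (Lmu phi L mu s) (A y) (B y) (C y)) a.
Proof.
move=> ls dL dpsi.
have := @derive_multipliers _ _ _ (la ^~ s) _ _ zd a e ls dL dpsi.
rewrite big_ord_recl /locT phi0 => H.
rewrite [X in _ = _ * X](_ : _ = 'D_e (fun y => loc x L (A y) (B y) (C y) -
  \sum_al la (lift ord0 al) s / la ord0 s *
    loc x (psi phi L al) (A y) (B y) (C y)) a); last first.
  congr ('D_e _ a); apply/funext => y; rewrite /loc /Lmu; congr (_ - _).
  by apply: eq_bigr => al _; rewrite mxE.
rewrite -H; congr (_ + _); apply: eq_bigr => al _.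
congr (_ * _); congr ('D_e _ a).
by apply/funext => y; exact: phi_zdot.
Qed.

Lemma reduced_of_vakonomic : reduced phi L c cz mu.
Proof.
have [[U [oU subU cU _ _]] dla eqs] := vak.
move=> t x t01 [ax dx]; have [E1 [dE2 E2] E3] := eqs t x t01 (conj ax dx).
have partials q v z : chart_image x q ->
    [/\ forall d, derivable (fun q' => loc x L q' v z) q d,
        forall d, derivable (fun v' => loc x L q v' z) v d
      & forall d, derivable (loc x L q v) z d] /\
    forall al,
    [/\ forall d, derivable (fun q' => loc x (psi phi L al) q' v z) q d,
        forall d, derivable (fun v' => loc x (psi phi L al) q v' z) v d
      & forall d, derivable (loc x (psi phi L al) q v) z d].
  move=> xq; split=> [|al]; apply: partials_derivable.
    by have [+ _] := L_smooth ax 1%N; exact.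
  exact: differentiable_psi.
(* Differentiating the momentum at [t] requires its formula at nearby times, possibly outside [0,1];
   the chart and the division by lambda_0 must remain valid there. *)
have near_dom : \forall s \near t, dom x (c s).
  by apply: (cU t (subU _ t01)); exact: open_nbhs_nbhs (conj (dom_open x) dx).
have near_la0 : \forall s \near t, la ord0 s != 0.
  have cla : la ord0 s @[s --> t] --> la ord0 t.
    exact/differentiable_continuous/derivable1_diffP/dla.
  exact: cvgr_neq0 cla (la0 t01).
have xct : chart_image x (x (c t)) by exists (c t).
have [[Lq Lv Lz] psiP] := partials _ (velocity (x \o c) t) (cz t) xct.
(* Replace L by the actual z' in the last argument of phi^alpha and use the constraint. *)
have psi0 al : loc x (psi phi L al) (x (c t)) (velocity (x \o c) t) (cz t) = 0.
  by rewrite /loc /psi (phi_zdot _ _ _ _ (derive1 cz t)); exact: E3.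
split=> [i||]; last 2 first.
- exact: psi0.
- have /eqP := E3 ord0; rewrite /locT phi0 subr_eq0 => /eqP ->.
  rewrite [RHS]/loc /Lmu big1 ?subr0// => al _.
  by rewrite [psi _ _ _ _ _]psi0 mulr0.
have [dp Ep] := E1 i.
apply: (herglotz_of_euler_lagrange (la0 t01) (dla ord0 t t01) dp).
- apply: filterS2 near_dom near_la0 => s ds ls.
  have xcs : chart_image x (x (c s)) by exists (c s).
  have [[_ Lvs _] psis] := partials _ (velocity (x \o c) s) (cz s) xcs.
  have psisv al := let: And3 _ H _ := psis al in H (delta_mx 0 i).
  exact: (@derive_vakonomic_multipliers x s _ (cst (x (c s))) id (cst (cz s))
    (derive1 cz s) _ _ ls (Lvs _) psisv).
- move/eqP: Ep; rewrite subr_eq0 => /eqP ->.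
  have psiq al := let: And3 H _ _ := psiP al in H (delta_mx 0 i).
  exact: (@derive_vakonomic_multipliers x t _ id
    (cst (velocity (x \o c) t)) (cst (cz t)) (derive1 cz t) _ _
    (la0 t01) (Lq _) psiq).
(* The momentum conjugate to z' is lambda_0, since only phi^0 depends on z'; the second vakonomic
   equation thus gives the derivative of lambda_0. *)
have p0 : (fun s => \sum_a la a s *
    derive1 (locT x (phi a) ((x \o c) s) (cz s) (velocity (x \o c) s))
      (derive1 cz s)) = la ord0.
  apply/funext => s; rewrite big_ord_recl big1 => [|al _].
    rewrite addr0 /locT phi0.
    by rewrite derive1_subr mulr1.
  rewrite (_ : locT _ _ _ _ _ = cst (locT x (phi (lift ord0 al)) ((x \o c) s)
    (cz s) (velocity (x \o c) s) 0)); last first.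
    by apply/funext => zd; exact: phi_zdot.
  by rewrite derive1_cst mulr0.
move: E2; rewrite p0 => /eqP; rewrite subr_eq0 => /eqP ->.
set zd := derive1 cz t; rewrite /pd_z derive1E.
under eq_bigr do rewrite derive1E.
have psiz al := let: And3 _ _ H := psiP al in H 1.
exact: (@derive_vakonomic_multipliers x t R (cst (x (c t)))
  (cst (velocity (x \o c) t)) id zd _ _ (la0 t01) (Lz _) psiz).
Qed.

End FromVakonomic.

(** * Partial derivatives and Herglotz equations of the extended Lagrangian *)

Lemma velocity_row_mx (q : R -> 'rV[R]_n) (mu : R -> 'rV[R]_k) t :
  velocity (fun s => row_mx (q s) (mu s)) t =
  row_mx (velocity q t) (velocity mu t).
Proof.
apply/rowP => j; rewrite mxE; case: (split_ordP j) => i ->.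
  rewrite row_mxEl mxE; congr (derive1 _ t).
  by apply/funext => s; rewrite row_mxEl.
rewrite row_mxEr mxE; congr (derive1 _ t).
by apply/funext => s; rewrite row_mxEr.
Qed.

Lemma lsubmx_delta_lshift (i : 'I_n) :
  lsubmx (delta_mx 0 (lshift k i) : 'rV[R]_(n + k)) = delta_mx 0 i.
Proof. by apply/rowP => j; rewrite !mxE !eqxx /= eq_lshift. Qed.

Lemma rsubmx_delta_lshift (i : 'I_n) :
  rsubmx (delta_mx 0 (lshift k i) : 'rV[R]_(n + k)) = 0.
Proof. by apply/rowP => j; rewrite !mxE !eqxx /= eq_rlshift. Qed.

Lemma lsubmx_delta_rshift (i : 'I_k) :
  lsubmx (delta_mx 0 (rshift n i) : 'rV[R]_(n + k)) = 0.
Proof. by apply/rowP => j; rewrite !mxE !eqxx /= eq_lrshift. Qed.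

Lemma rsubmx_delta_rshift (i : 'I_k) :
  rsubmx (delta_mx 0 (rshift n i) : 'rV[R]_(n + k)) = delta_mx 0 i.
Proof. by apply/rowP => j; rewrite !mxE !eqxx /= eq_rshift. Qed.

Section ExtendedLagrangian.
Variables (x : chart R n Q) (mu : R -> 'rV[R]_k) (s : R).
Variables (q v : 'rV[R]_n) (w : 'rV[R]_k) (z : R).

Let F := loc x (Lmu phi L mu s).

Lemma locLextE : locLext phi L x (row_mx q (mu s)) (row_mx v w) z = F q v z.
Proof. by rewrite /locLext !row_mxKl !row_mxKr. Qed.

Lemma pd_v_locLext_lshift i :
  pd_v (locLext phi L x) (lshift k i) (row_mx q (mu s)) (row_mx v w) z =
  pd_v F i q v z.
Proof.
have E (h : R) : locLext phi L x (row_mx q (mu s))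
    (h *: delta_mx 0 (lshift k i) + row_mx v w) z =
    F q (h *: delta_mx 0 i + v) z.
  rewrite /locLext !linearD !linearZ /= !row_mxKl !row_mxKr.
  by rewrite lsubmx_delta_lshift.
by have [] := @derive_along _ _ _ _ (fun v' => locLext phi L x _ v' z)
  (fun v' => F q v' z) (row_mx v w) _ v _ E.
Qed.

Lemma pd_v_locLext_rshift al :
  pd_v (locLext phi L x) (rshift n al) (row_mx q (mu s)) (row_mx v w) z = 0.
Proof.
have E (h : R) : locLext phi L x (row_mx q (mu s))
    (h *: delta_mx 0 (rshift n al) + row_mx v w) z =
    cst (F q v z) (h *: (0 : R^o) + 0).
  rewrite /locLext !linearD !linearZ /= !row_mxKl !row_mxKr.
  by rewrite lsubmx_delta_rshift scaler0 add0r.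
have [+ _] := @derive_along _ _ _ _ (fun v' => locLext phi L x _ v' z)
  (cst (F q v z)) (row_mx v w) _ _ _ E.
by rewrite /pd_v => ->; exact: derive_cst.
Qed.

Lemma pd_q_locLext_lshift i :
  pd_q (locLext phi L x) (lshift k i) (row_mx q (mu s)) (row_mx v w) z =
  pd_q F i q v z.
Proof.
have E (h : R) : locLext phi L x
    (h *: delta_mx 0 (lshift k i) + row_mx q (mu s)) (row_mx v w) z =
    F (h *: delta_mx 0 i + q) v z.
  rewrite /locLext !linearD !linearZ /= !row_mxKl !row_mxKr.
  by rewrite lsubmx_delta_lshift rsubmx_delta_lshift scaler0 add0r.
by have [] := @derive_along _ _ _ _ (fun q' => locLext phi L x q' _ z)
  (fun q' => F q' v z) (row_mx q (mu s)) _ q _ E.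
Qed.

Lemma pd_q_locLext_rshift al :
  pd_q (locLext phi L x) (rshift n al) (row_mx q (mu s)) (row_mx v w) z =
  - loc x (psi phi L al) q v z.
Proof.
set P := loc x (psi phi L al) q v z.
(* Along the direction mu_alpha the extended Lagrangian is affine in [h], with slope [- P]. *)
have E (h : R) : locLext phi L x
    (h *: delta_mx 0 (rshift n al) + row_mx q (mu s)) (row_mx v w) z =
    (cst (F q v z) - P *: id) (h *: 1 + 0).
  rewrite /locLext !linearD !linearZ /= !row_mxKl !row_mxKr.
  rewrite lsubmx_delta_rshift rsubmx_delta_rshift scaler0 add0r addr0.
  rewrite !fctE /F /loc /Lmu /Lext -addrA scalerN -opprD.
  congr (_ - _).
  (* The increment of mu contributes a sum with a Kronecker delta, of which only the term [al]
     survives. *)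
  rewrite (eq_bigr (fun al' => mu s 0 al' *
      psi phi L al' (tvec x (chart_inv x q) v) z +
      (al' == al)%:R * h * psi phi L al' (tvec x (chart_inv x q) v) z));
    last first.
    by move=> al' _; rewrite !mxE eqxx /= -mulrDl addrC [h * _]mulrC.
  rewrite big_split /=; congr (_ + _).
  rewrite (bigD1 al)//= big1 ?addr0 => [|al' /negPf ->]; last by rewrite !mul0r.
  by rewrite eqxx mul1r mulrC [_ *: 1]mulr1.
have [+ _] := @derive_along _ _ _ _ (fun q' => locLext phi L x q' _ z)
  (cst (F q v z) - P *: id) (row_mx q (mu s)) _ _ _ E.
rewrite /pd_q => ->.
have dP := is_deriveZ P (is_derive_id (0 : R) 1).
have := is_deriveB (is_derive_cst (F q v z) (0 : R) 1) dP.
by move=> /@derive_val ->; rewrite sub0r [_ *: _]mulr1.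
Qed.

Lemma pd_z_locLext :
  pd_z (locLext phi L x) (row_mx q (mu s)) (row_mx v w) z = pd_z F q v z.
Proof.
congr (derive1 _ z); apply/funext => z'.
by rewrite /locLext !row_mxKl !row_mxKr.
Qed.

End ExtendedLagrangian.

(** At each time [s] the q-partials of [locLext] at [mu s] are those of [Lmu] with time frozen at
    [s]. The momenta therefore agree as functions of [s], and so do their total derivatives,
    variation of mu included. *)
Lemma reduced_at_herglotz (c : R -> Q) (cz : R -> R) (mu : R -> 'rV[R]_k)
    (x : chart R n Q) t :
  reduced_at phi L c cz mu x t <->
  herglotz (locLext phi L x) (fun s => row_mx (x (c s)) (mu s)) cz t.
Proof.
have pE i : (fun s => pd_v (locLext phi L x) (lshift k i)
      (row_mx (x (c s)) (mu s))
      (velocity (fun s => row_mx (x (c s)) (mu s)) s) (cz s)) =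
    (fun s => pd_v (loc x (Lmu phi L mu s)) i (x (c s))
      (velocity (x \o c) s) (cz s)).
  by apply/funext => s; rewrite velocity_row_mx pd_v_locLext_lshift.
have p0 al : (fun s => pd_v (locLext phi L x) (rshift n al)
      (row_mx (x (c s)) (mu s))
      (velocity (fun s => row_mx (x (c s)) (mu s)) s) (cz s)) = cst 0.
  by apply/funext => s; rewrite velocity_row_mx pd_v_locLext_rshift.
split=> [[EL psi0 Ecz]|[EL Ecz]].
  split; last by rewrite velocity_row_mx locLextE.
  move=> j; case: (split_ordP j) => [i|al] -> /=.
    rewrite pE velocity_row_mx pd_q_locLext_lshift pd_v_locLext_lshift.
    by rewrite pd_z_locLext; exact: EL.
  (* The momentum conjugate to mu_alpha vanishes at all times, so only the derivative in mu_alpha,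
     equal to - psi^alpha, is left. *)
  rewrite p0 velocity_row_mx pd_q_locLext_rshift pd_v_locLext_rshift mul0r.
  split; first exact: derivable_cst.
  by rewrite derive1_cst opprK add0r; exact: psi0.
split=> [i|al|].
- have := EL (lshift k i); rewrite /= pE velocity_row_mx pd_q_locLext_lshift.
  by rewrite pd_v_locLext_lshift pd_z_locLext.
- have := EL (rshift n al); rewrite /= p0 velocity_row_mx.
  rewrite pd_q_locLext_rshift pd_v_locLext_rshift mul0r derive1_cst opprK add0r.
  by case.
by rewrite Ecz velocity_row_mx locLextE.
Qed.

End Reduction.

Theorem mainTheorem3 (R : realType) (n k : nat) (Q : smoothManifold R n)
    (L : tangent Q -> R -> R) (N : set (tangent Q * R * R))
    (phi : 'I_k.+1 -> tangent Q -> R -> R -> R)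
    (L_smooth : smooth_lagrangian L)
    (N_phi : defined_by N phi)
    (phi0 : phi ord0 = fun w z zd => zd - L w z) :
  [/\ (forall w z zd, derive1 (phi ord0 w z) zd != 0),
      (exists phi' : 'I_k.+1 -> tangent Q -> R -> R -> R,
        [/\ defined_by N phi', phi' ord0 = phi ord0
          & forall (al : 'I_k) w z zd zd',
              phi' (lift ord0 al) w z zd = phi' (lift ord0 al) w z zd']),
      ((forall (al : 'I_k) w z zd zd',
          phi (lift ord0 al) w z zd = phi (lift ord0 al) w z zd') ->
       forall (c : R -> Q) (cz : R -> R) (la : 'I_k.+1 -> R -> R),
         vakonomic phi c cz la ->
         (forall t, `[0, 1]%classic t -> la ord0 t != 0) ->
         reduced phi L c cz
           (fun t => \row_(al < k) (la (lift ord0 al) t / la ord0 t)))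
    & (forall (c : R -> Q) (cz : R -> R) (mu : R -> 'rV[R]_k),
         smooth_path c cz ->
         (forall t, `[0, 1]%classic t -> derivable mu t 1) ->
         reduced phi L c cz mu <-> herglotz_Lext phi L c cz mu)].
Proof.
split.
- by move=> w z zd; rewrite phi0 derive1_subr oner_neq0.
- exists (eliminate_zdot L phi); split=> //.
  exact: defined_by_eliminate_zdot.
- move=> phi_zdot c cz la vak la0; have [phi_smooth _ _] := N_phi.
  exact: reduced_of_vakonomic.
move=> c cz mu _ _; split=> H t x t01 ctx; apply/reduced_at_herglotz; exact: H.
Qed.
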